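(* The set of S-graphs (finite and infinite) and the set of worm graphs are the same, up to isomorphism preserving directions and colors of edges: every worm graph $W(a_1,b_1;a_2,b_2)$ is isomorphic to an S-graph $S(A,B)$, and every S-graph $S(A,B)$ is isomorphic to a worm graph.
   Context: **Worm graphs.** A six-tuple of integers $(x',y,x'';y',x,y'')$ is admissible if: (A) $x'$ and $x''$ are even; (B) $y''\ge y\ge y'$ and $x''\ge x\ge x'$; (C) if $y''>y$ then $x''=x$, and if $y>y'$ then $x=x'$. The free worm graph $F$ is the 2-edge-colored digraph whose vertices are all admissible six-tuples, with an edge of color 1 from $v$ to $\mathbf1v$ and an edge of color 2 from $v$ to $\mathbf2v$ for each vertex $v=(x',y,x'';y',x,y'')$, where $\mathbf1$ acts by: (i) if $2x>x'+x''$ then $x'$ increases by 2; (ii) if $x=x'=x''$ and $y''>y$ then $y$ increases by 1; (iii) otherwise $x''$ increases by 2; and $\mathbf2$ acts by: (iv) if $2y>y'+y''$ then $y'$ increases by 1; (v) if $y''=y=y'$ and $x''>x$ then $x$ increases by 1; (vi) otherwise $y''$ increases by 1 (all other entries being preserved). For $a_1,a_2\in\mathbb{Z}\cup\{-\infty\}$, $b_1,b_2\in\mathbb{Z}\cup\{+\infty\}$ with $a_1\le b_1$, $a_2\le b_2$, the worm graph $W(a_1,b_1;a_2,b_2)$ is the subgraph of $F$ induced by the admissible six-tuples with $2a_1\le x'$, $x''\le 2b_1$, $a_2\le y'$, $y''\le b_2$. **RA2-graphs.** Let each of $A,B$ be one of the index sets $\{0,1,\dots,a\}$ ($a\in\mathbb{Z}_{\ge0}$),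 $\mathbb{Z}_{\ge 0}$, $\mathbb{Z}_{\le 0}$, $\mathbb{Z}$. The right $A$-sail $R$ has vertices $(i,j)\in A^2$ with $j\le i$; the left $A$-sail $L$ has vertices $(i,j)\in B^2$ with $i\le j$; in both, all pairs $((i,j),(i+1,j))$ are edges of color I and all pairs $((i,j),(i,j+1))$ are edges of color II. The RA2-graph $C(A,B)$ is obtained from disjoint copies $R_j$ ($j\in B$) of $R$ and $L_i$ ($i\in A$) of $L$ by identifying, for every $(i,j)\in A\times B$, the vertex $(i,i)$ of $R_j$ with the vertex $(j,j)$ of $L_i$; the resulting vertex is called the principal vertex $(i,j)$. Each maximal path of color I (I-string) and each maximal path of color II (II-string) contains exactly one principal vertex. A vertex of $C(A,B)$ is an $\otimes$-vertex if it is a vertex $(k,l)$ of some $L_i$ with $l-k$ odd. **$B$-sails.** For $r,m\in\mathbb{Z}_{\ge0}\cup\{\infty\}$, the left $B$-sail has as vertices the integer points $(p,q)$ with $-r\le p\le q\le m$, $q\ge 2p$, and the half-integer points $(k+\frac12,2k+1)$ with $k\in\mathbb{Z}_{\ge0}$, $2k+1\le m$. Its edges are all pairs $((p,q),(p+1,q))$ (color 1) and $((p,q),(p,q+1))$ (color 2) of its integer vertices, and the left half-edges $((k,2k+1),(k+\frac12,2k+1))$ (color 1). Its diagonal is the sequence $d_t$, $t\in\mathbb{Z}$, $-r\le t\le m$, where $d_t=(t,t)$ for $t\le 0$ and $d_t=(t/2,t)$ for $t\ge0$. For $n,q\in\mathbb{Z}_{\ge0}\cup\{\infty\}$, the right $B$-sail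 has as vertices the integer points $(p,s)$ with $-n\le s\le p\le q$, $s\le 2p$, and the points $(-k-\frac12,-2k-1)$ with $k\in\mathbb{Z}_{\ge0}$, $2k+1\le n$. Its edges are all pairs $((p,s),(p+1,s))$ (color 1) and $((p,s),(p,s+1))$ (color 2) of its integer vertices, and the right half-edges $((-k-\frac12,-2k-1),(-k,-2k-1))$ (color 1). Its diagonal is $d_t$, $-n\le t\le q$, with $d_t=(t/2,t)$ for $t\le0$ and $d_t=(t,t)$ for $t\ge0$. **S-graphs.** The S-graph $S(A,B)$ is obtained from $C=C(A,B)$ as follows. For each II-string $P$ with principal vertex $(i,j)$ take a left $B$-sail with $r=|\{k\in A:k<i\}|$, $m=|\{k\in B:k>j\}|$ and identify the vertices of $P$, in their order, with the diagonal $(d_t)$, the principal vertex being identified with $d_0$. For each I-string $P$ with principal vertex $(i,j)$ take a right $B$-sail with $q=|\{k\in A:k>i\}|$, $n=|\{k\in B:k<j\}|$ and identify the vertices of $P$, in their order, with its diagonal, the principal vertex being identified with $d_0$. Delete all edges of $C$. Each $\otimes$-vertex $w$ is then incident to exactly one left half-edge $(u,w)$ and one right half-edge $(w,z)$; replace these by a single edge $(u,z)$ of color 1 and delete $w$. *)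

(* Defs.v *)
From Stdlib Require Import ZArith Bool Lia List Relation_Operators FinFun.
From Stdlib Require Import ClassicalEpsilon.
Set Implicit Arguments.
Open Scope Z_scope.

(** * Edge-2-coloured digraphs *)

(* [One] also stands for the colour I and [Two] for the colour II. *)
Inductive color := One | Two.

(* All graphs considered here have at most one edge of each colour between two
   given vertices, so the edges of each colour form a relation. *)
Record digraph := Digraph {
  vertex : Type;
  edge : color -> vertex -> vertex -> Prop
}.

Definition isomorphic (G H : digraph) : Prop :=
  exists f : vertex G -> vertex H,
    Bijective f /\ forall c u v, edge G c u v <-> edge H c (f u) (f v).

Definition induced (G : digraph) (P : vertex G -> Prop) : digraph :=
  {| vertex := {v : vertex G | P v};
     edge c u v := edge G c (proj1_sig u) (proj1_sig v) |}.

(** Identification of vertices: the classes of the equivalence relation generated by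
    a relation [E] relating the pairs of elements to be identified. *)
Definition quotient (T : Type) (E : T -> T -> Prop) : Type :=
  {X : T -> Prop | exists x, X = clos_refl_sym_trans T E x}.

Definition class (T : Type) (E : T -> T -> Prop) (x : T) : quotient E :=
  exist _ (clos_refl_sym_trans T E x) (ex_intro _ x eq_refl).

Definition quotient_graph (G : digraph) (E : vertex G -> vertex G -> Prop) : digraph :=
  {| vertex := quotient E;
     edge c X Y := exists x y, X = class E x /\ Y = class E y /\ edge G c x y |}.

(** A path of colour [c] is a family [p] indexed by an interval [D] of the integers (the
    values of [p] outside [D] are irrelevant). *)
Definition is_path (G : digraph) (c : color) (D : Z -> Prop) (p : Z -> vertex G) : Prop :=
  (forall s t u, D s -> D u -> s <= t <= u -> D t) /\
  (forall t, D t -> D (t + 1) -> edge G c (p t) (p (t + 1))).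

Definition is_maximal_path (G : digraph) (c : color) (D : Z -> Prop)
    (p : Z -> vertex G) : Prop :=
  is_path G c D p /\
  forall D' p', is_path G c D' p' ->
    (forall t, D t -> D' t /\ p' t = p t) -> forall t, D' t -> D t.

(** * Worm graphs *)

(* [wx1], [wx2], [wy1], [wy2] stand for x', x'', y', y''. *)
Record six_tuple := SixTuple { wx1 : Z; wx : Z; wx2 : Z; wy1 : Z; wy : Z; wy2 : Z }.

Definition admissible (v : six_tuple) : Prop :=
  let (x1, x, x2, y1, y, y2) := v in
  (Z.Even x1 /\ Z.Even x2) /\
  (y1 <= y <= y2 /\ x1 <= x <= x2) /\
  ((y < y2 -> x2 = x) /\ (y1 < y -> x = x1)).

Definition act1 (v : six_tuple) : six_tuple :=
  let (x1, x, x2, y1, y, y2) := v in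
  if x1 + x2 <? 2 * x then SixTuple (x1 + 2) x x2 y1 y y2
  else if (x =? x1) && (x =? x2) && (y <? y2) then SixTuple x1 x x2 y1 (y + 1) y2
  else SixTuple x1 x (x2 + 2) y1 y y2.

Definition act2 (v : six_tuple) : six_tuple :=
  let (x1, x, x2, y1, y, y2) := v in
  if y1 + y2 <? 2 * y then SixTuple x1 x x2 (y1 + 1) y y2
  else if (y =? y1) && (y =? y2) && (x <? x2) then SixTuple x1 (x + 1) x2 y1 y y2
  else SixTuple x1 x x2 y1 y (y2 + 1).

Definition act (c : color) : six_tuple -> six_tuple :=
  match c with One => act1 | Two => act2 end.

Lemma act_admissible c v : admissible v -> admissible (act c v).
Proof.
destruct v as [x1 x x2 y1 y y2]; intros [[[i Hi] [j Hj]] [[Hy Hx] [Hc Hd]]].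
destruct c; unfold act, act1, act2.
- destruct (Z.ltb_spec (x1 + x2) (2 * x)), (Z.eqb_spec x x1), (Z.eqb_spec x x2),
    (Z.ltb_spec y y2); cbn [andb]; repeat split; unfold Z.Even; try lia;
  first [exists i; lia | exists j; lia | exists (i + 1); lia | exists (j + 1); lia].
- destruct (Z.ltb_spec (y1 + y2) (2 * y)), (Z.eqb_spec y y1), (Z.eqb_spec y y2),
    (Z.ltb_spec x x2); cbn [andb]; repeat split; unfold Z.Even; try lia;
  first [exists i; lia | exists j; lia].
Qed.

Definition free_worm : digraph :=
  {| vertex := {v : six_tuple | admissible v};
     edge c v w := proj1_sig w = act c (proj1_sig v) |}.

(* In a lower bound [None] is minus infinity, in an upper bound plus infinity. *)
Definition above (a : option Z) (z : Z) : Prop :=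
  match a with Some a => a <= z | None => True end.
Definition below (b : option Z) (z : Z) : Prop :=
  match b with Some b => z <= b | None => True end.
Definition bounds_le (a b : option Z) : Prop :=
  match a, b with Some a, Some b => a <= b | _, _ => True end.
Definition double (a : option Z) : option Z := option_map (Z.mul 2) a.

Definition worm (a1 b1 a2 b2 : option Z) : digraph :=
  induced free_worm (fun v =>
    above (double a1) (wx1 (proj1_sig v)) /\ below (double b1) (wx2 (proj1_sig v)) /\
    above a2 (wy1 (proj1_sig v)) /\ below b2 (wy2 (proj1_sig v))).

(** * RA2-graphs *)

Inductive index_set := Segment (a : nat) | NonNegatives | NonPositives | Integers.

Definition mem (A : index_set) (k : Z) : Prop :=
  match A with
  | Segment a => 0 <= k <= Z.of_nat a
  | NonNegatives => 0 <= k
  | NonPositives => k <= 0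
  | Integers => True
  end.

Definition elt (A : index_set) : Type := {k : Z | mem A k}.

(* [right_sail] is to be used with A and [left_sail] with B. *)
Definition right_sail (A : index_set) : Type :=
  {v : Z * Z | mem A (fst v) /\ mem A (snd v) /\ snd v <= fst v}.
Definition left_sail (B : index_set) : Type :=
  {v : Z * Z | mem B (fst v) /\ mem B (snd v) /\ fst v <= snd v}.

Definition grid_edge (c : color) (u v : Z * Z) : Prop :=
  match c with
  | One => v = (fst u + 1, snd u)
  | Two => v = (fst u, snd u + 1)
  end.

Section RA2.
Variables A B : index_set.

Inductive sails_vertex :=
| inR (j : elt B) (v : right_sail A)
| inL (i : elt A) (v : left_sail B).

Definition sails : digraph :=
  {| vertex := sails_vertex;
     edge c u v :=
       match u, v with
       | inR j u, inR j' v => j = j' /\ grid_edge c (proj1_sig u) (proj1_sig v)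
       | inL i u, inL i' v => i = i' /\ grid_edge c (proj1_sig u) (proj1_sig v)
       | _, _ => False
       end |}.

Definition diag_R (i : elt A) : right_sail A :=
  exist _ (proj1_sig i, proj1_sig i)
    (conj (proj2_sig i) (conj (proj2_sig i) (Z.le_refl _))).
Definition diag_L (j : elt B) : left_sail B :=
  exist _ (proj1_sig j, proj1_sig j)
    (conj (proj2_sig j) (conj (proj2_sig j) (Z.le_refl _))).

Inductive sails_glue : sails_vertex -> sails_vertex -> Prop :=
| glue_principal i j : sails_glue (inR j (diag_R i)) (inL i (diag_L j)).

Definition RA2 : digraph := quotient_graph sails sails_glue.

Definition principal (i : elt A) (j : elt B) : vertex RA2 :=
  class sails_glue (inR j (diag_R i)).

Definition otimes (v : vertex RA2) : Prop :=
  exists (i : elt A) (w : left_sail B),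
    v = class sails_glue (inL i w) /\ Z.Odd (snd (proj1_sig w) - fst (proj1_sig w)).

End RA2.

(** * B-sails *)

(* Elements of Z>=0 with infinity are encoded in [option nat], [None] being infinity. *)
Definition le_inf (z : Z) (n : option nat) : Prop :=
  match n with Some n => z <= Z.of_nat n | None => True end.

(* A point (p,q) of the half-integer grid is encoded as the pair (2p,q) of integers. *)
Definition in_left_Bsail (r m : option nat) (v : Z * Z) : Prop :=
  (exists p q, v = (2 * p, q) /\ le_inf (- p) r /\ p <= q /\ le_inf q m /\ 2 * p <= q) \/
  (exists k, v = (2 * k + 1, 2 * k + 1) /\ 0 <= k /\ le_inf (2 * k + 1) m).

Definition in_right_Bsail (n q : option nat) (v : Z * Z) : Prop :=
  (exists p s, v = (2 * p, s) /\ le_inf (- s) n /\ s <= p /\ le_inf p q /\ s <= 2 * p) \/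
  (exists k, v = (- (2 * k) - 1, - (2 * k) - 1) /\ 0 <= k /\ le_inf (2 * k + 1) n).

Definition left_Bsail (r m : option nat) : Type := {v : Z * Z | in_left_Bsail r m v}.
Definition right_Bsail (n q : option nat) : Type := {v : Z * Z | in_right_Bsail n q v}.

Definition Bsail_edge (c : color) (u v : Z * Z) : Prop :=
  exists p q, u = (2 * p, q) /\
    v = match c with One => (2 * (p + 1), q) | Two => (2 * p, q + 1) end.

Definition left_half_edge (u v : Z * Z) : Prop :=
  exists k, u = (2 * k, 2 * k + 1) /\ v = (2 * k + 1, 2 * k + 1).
Definition right_half_edge (u v : Z * Z) : Prop :=
  exists k, u = (- (2 * k) - 1, - (2 * k) - 1) /\ v = (- (2 * k), - (2 * k) - 1).

Definition left_diagonal (t : Z) : Z * Z := if t <=? 0 then (2 * t, t) else (t, t).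
Definition right_diagonal (t : Z) : Z * Z := if t <=? 0 then (t, t) else (2 * t, t).

(** * S-graphs *)

Definition enumerates (l : list Z) (X : Z -> Prop) : Prop :=
  NoDup l /\ forall k, In k l <-> X k.

(* The cardinality of a set of integers, [None] when it is infinite. *)
Definition card (X : Z -> Prop) : option nat :=
  match excluded_middle_informative (exists l, enumerates l X) with
  | left h => Some (length (proj1_sig (constructive_indefinite_description _ h)))
  | right _ => None
  end.

Definition card_before (A : index_set) (i : elt A) : option nat :=
  card (fun k => mem A k /\ k < proj1_sig i).
Definition card_after (A : index_set) (i : elt A) : option nat :=
  card (fun k => mem A k /\ k > proj1_sig i).

Section SGraph.
Variables A B : index_set.

(* Each II-string, and each I-string, contains exactly one principal vertex, and through
   each principal vertex passes exactly one string of each colour.  The B-sails attached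
   to the strings are therefore indexed by the principal vertices (i,j). *)
Inductive piece :=
| frame (v : vertex (RA2 A B))
| left_piece (i : elt A) (j : elt B) (v : left_Bsail (card_before i) (card_after j))
| right_piece (i : elt A) (j : elt B) (v : right_Bsail (card_before j) (card_after i)).

(* The string with principal vertex (i,j) is parametrised so that its vertex of index 0 is
   the principal one. *)
Inductive piece_glue : piece -> piece -> Prop :=
| glue_left i j D p t (v : left_Bsail (card_before i) (card_after j)) :
    is_maximal_path (RA2 A B) Two D p -> D 0 -> p 0 = principal i j ->
    D t -> proj1_sig v = left_diagonal t ->
    piece_glue (frame (p t)) (left_piece i j v)
| glue_right i j D p t (v : right_Bsail (card_before j) (card_after i)) :
    is_maximal_path (RA2 A B) One D p -> D 0 -> p 0 = principal i j ->
    D t -> proj1_sig v = right_diagonal t ->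
    piece_glue (frame (p t)) (right_piece i j v).

Definition glued : Type := quotient piece_glue.

(* The image in [glued] of a family of edges of the left, resp. right, B-sails. *)
Definition left_image (E : Z * Z -> Z * Z -> Prop) (X Y : glued) : Prop :=
  exists i j u v, X = class piece_glue (left_piece i j u) /\
    Y = class piece_glue (left_piece i j v) /\ E (proj1_sig u) (proj1_sig v).
Definition right_image (E : Z * Z -> Z * Z -> Prop) (X Y : glued) : Prop :=
  exists i j u v, X = class piece_glue (right_piece i j u) /\
    Y = class piece_glue (right_piece i j v) /\ E (proj1_sig u) (proj1_sig v).

Definition is_otimes (X : glued) : Prop :=
  exists v : vertex (RA2 A B), otimes v /\ X = class piece_glue (frame v).

Definition S_edge (c : color) (X Y : glued) : Prop :=
  left_image (Bsail_edge c) X Y \/ right_image (Bsail_edge c) X Y \/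
  (c = One /\ exists w, is_otimes w /\
     left_image left_half_edge X w /\ right_image right_half_edge w Y).

Definition S_graph : digraph :=
  {| vertex := {X : glued | ~ is_otimes X};
     edge c X Y := S_edge c (proj1_sig X) (proj1_sig Y) |}.

End SGraph.

(* Main.v *)
Require Import Defs.
From Stdlib Require Import ZArith Lia List Relation_Operators FinFun.
From Stdlib Require Import ClassicalEpsilon FunctionalExtensionality PropExtensionality
  ProofIrrelevance.

(* Give a vertex of the left B-sail of a II-string with principal vertex (i,j) the
   coordinates x'' = 2i, y' = j, and of the right B-sail of a I-string the coordinates
   x' = 2i, y'' = j; the position (p,q) in the sail determines the other coordinates.  Both
   prescriptions agree on the strings of C(A,B), where they give
   2x = x' + x'', 2y = y' + y''.  The left sails then fill the region 2x >= x' + x'',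
   2y <= y' + y'' of the admissible six-tuples and the right sails the opposite region, the
   edges of a sail being the actions that stay in its region.  The only action that jumps
   across is (ii) with 2y + 1 = y' + y'': it passes over an otimes-vertex. *)

Open Scope Z_scope.

Local Arguments Z.add : simpl never.
Local Arguments Z.mul : simpl never.
Local Arguments Z.opp : simpl never.
Local Arguments Z.sub : simpl never.
Local Arguments Z.min : simpl never.
Local Arguments Z.max : simpl never.
Local Arguments Z.div : simpl never.

Lemma sig_eq T (P : T -> Prop) (u v : sig P) : proj1_sig u = proj1_sig v -> u = v.
Proof. destruct u, v; cbn; intros; now apply subset_eq_compat. Qed.

(** * Quotients *)

Section Quotients.
Context {T S : Type} {E : T -> T -> Prop}.

Lemma class_eq x y : clos_refl_sym_trans T E x y -> class E x = class E y.
Proof.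
intros H; apply sig_eq, functional_extensionality; intros z; cbn.
apply propositional_extensionality; split; intros; eapply rst_trans; eauto.
now apply rst_sym.
Qed.

Lemma class_inj x y : class E x = class E y -> clos_refl_sym_trans T E x y.
Proof.
intros H; apply (f_equal (@proj1_sig _ _)) in H; cbn in H; rewrite H; apply rst_refl.
Qed.

Lemma class_surj (X : quotient E) : exists x, X = class E x.
Proof. destruct X as [X [x ->]]; exists x; now apply sig_eq. Qed.

(** A representative is chosen arbitrarily, so the value is meaningful only when [f] agrees on all
    pairs related by [E], the hypothesis of [lift_class]. *)
Definition lift (f : T -> S) (X : quotient E) : S :=
  f (proj1_sig (constructive_indefinite_description _ (class_surj X))).

Lemma lift_class f x : (forall x y, E x y -> f x = f y) -> lift f (class E x) = f x.
Proof.
intros Hf; unfold lift; destruct constructive_indefinite_description as [y Hy]; cbn.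
apply class_inj in Hy; symmetry; induction Hy; auto; congruence.
Qed.

End Quotients.

(** * Isomorphisms and monochromatic paths *)

Lemma isomorphic_sym G H : isomorphic G H -> isomorphic H G.
Proof.
intros [f [[g [Hgf Hfg]] Hf]]; exists g; split.
- exists f; auto.
- intros c u v; rewrite Hf, !Hfg; tauto.
Qed.

Lemma isomorphism_intro G H (f : vertex G -> vertex H) :
  (forall u v, f u = f v -> u = v) -> (forall w, exists u, f u = w) ->
  (forall c u v, edge G c u v <-> edge H c (f u) (f v)) -> isomorphic G H.
Proof.
intros Hinj Hsurj He; exists f; split; auto.
exists (fun w => proj1_sig (constructive_indefinite_description _ (Hsurj w))); split;
  intros; destruct constructive_indefinite_description as [u Hu]; cbn; auto.
Qed.

(** The values are propagated from index 0 by two inductions, upwards and downwards; hence the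
    successor must be determined only for [0 <= t], and the predecessor only for [t < 0]. *)
Lemma path_values (G : digraph) (T : Type) (val : vertex G -> T) (e : Z -> T) c D p :
  (forall X Y t, edge G c X Y -> 0 <= t -> val X = e t -> val Y = e (t + 1)) ->
  (forall X Y t, edge G c X Y -> t < 0 -> val Y = e (t + 1) -> val X = e t) ->
  is_path G c D p -> D 0 -> val (p 0) = e 0 -> forall t, D t -> val (p t) = e t.
Proof.
intros Hup Hdown [Hconv Hpath] D0 H0.
assert (Hpos : forall t, 0 <= t -> D t -> val (p t) = e t).
{ apply (natlike_ind (fun t => D t -> val (p t) = e t)); auto.
  intros t Ht IH HD; assert (D t) by (apply (Hconv 0 t (Z.succ t)); auto; lia).
  apply (Hup (p t)); auto. }
assert (Hneg : forall t, 0 <= t -> D (- t) -> val (p (- t)) = e (- t)).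
{ apply (natlike_ind (fun t => D (- t) -> val (p (- t)) = e (- t))); auto.
  intros t Ht IH HD; assert (D (- t)) by (apply (Hconv (- Z.succ t) (- t) 0); auto; lia).
  replace (- t) with (- Z.succ t + 1) in * by lia.
  apply (Hdown _ (p (- Z.succ t + 1))); auto; lia. }
intros t HD; destruct (Z_le_gt_dec 0 t); auto.
replace t with (- - t) in * by lia; apply Hneg; auto; lia.
Qed.

(** * Cardinalities *)

Lemma mem_convex A s t u : mem A s -> mem A u -> s <= t <= u -> mem A t.
Proof. destruct A; cbn; lia. Qed.

Lemma finite_subset (X : Z -> Prop) l :
  (forall k, X k -> In k l) -> exists l', enumerates l' X /\ incl l' l.
Proof.
intros H.
set (f := fun k => if excluded_middle_informative (X k) then true else false).
assert (Hf : forall k, f k = true <-> X k).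
{ intros k; unfold f; destruct excluded_middle_informative; split; easy. }
exists (filter f (nodup Z.eq_dec l)); repeat split.
- apply NoDup_filter, NoDup_nodup.
- rewrite filter_In, Hf; tauto.
- rewrite filter_In, Hf, nodup_In; auto.
- intros k; rewrite filter_In, nodup_In; tauto.
Qed.

(** [X] is an initial segment of the ray that leaves [i] in direction [e], without [i] itself. If
    its [t]-th point is missing, [X] sits inside the first [t - 1] points; if it is present, so are
    the first [t]. *)
Lemma le_inf_card_ray X i e t :
  e = 1 \/ e = -1 -> (forall k, X k -> 0 < e * (k - i)) ->
  (forall s u, 0 < s <= u -> X (i + e * u) -> X (i + e * s)) ->
  0 < t -> le_inf t (card X) <-> X (i + e * t).
Proof.
intros He Hpos Hconv Ht.
set (ray := fun n => map (fun k => i + e * Z.of_nat k) (seq 1 n)).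
assert (Hray : forall n k, In k (ray n) <-> 0 < e * (k - i) <= Z.of_nat n).
{ intros n k; unfold ray; rewrite in_map_iff; split.
  - intros [s [<- Hs]]; apply in_seq in Hs; destruct He; subst e; lia.
  - intros H; exists (Z.to_nat (e * (k - i))); rewrite in_seq; destruct He; subst e; lia. }
assert (Hlen : forall n, length (ray n) = n)
  by (intros; unfold ray; now rewrite length_map, length_seq).
unfold card; split.
- intros Hle; destruct (excluded_middle_informative (X (i + e * t))) as [|HX]; auto.
  exfalso.
  assert (Hsub : forall k, X k -> In k (ray (Z.to_nat (t - 1)))).
  { intros k Hk; apply Hray; split; auto.
    destruct (Z_le_gt_dec t (e * (k - i))); [|lia].
    destruct HX; apply (Hconv t (e * (k - i))); [lia|].
    replace (i + e * (e * (k - i))) with k by (destruct He; subst e; lia); auto. }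
  (* Being inside a finite list excludes the infinite value of [card]. *)
  destruct (finite_subset _ _ Hsub) as [l [Hl Hincl]].
  destruct excluded_middle_informative as [h|n]; [|apply n; now exists l].
  destruct constructive_indefinite_description as [l' [Hnd Hl']]; cbn in Hle.
  assert (Hlength := NoDup_incl_length Hnd (l' := ray (Z.to_nat (t - 1)))
    (fun k Hk => Hsub k (proj1 (Hl' k) Hk))).
  rewrite Hlen in Hlength; lia.
- intros HX; destruct excluded_middle_informative as [h|n]; cbn; auto.
  destruct constructive_indefinite_description as [l [Hnd Hl]]; cbn.
  assert (Hray_nd : NoDup (ray (Z.to_nat t))).
  { apply Injective_map_NoDup; [|apply seq_NoDup].
    intros m n; destruct He; subst e; lia. }
  assert (Hincl : incl (ray (Z.to_nat t)) l).
  { intros k Hk; apply Hl; apply Hray in Hk.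
    replace k with (i + e * (e * (k - i))) by (destruct He; subst e; lia).
    apply (Hconv _ t); auto; lia. }
  assert (H := NoDup_incl_length Hray_nd Hincl); rewrite Hlen in H; lia.
Qed.

Lemma le_inf_nonpos t n : t <= 0 -> le_inf t n.
Proof. destruct n; cbn; lia. Qed.

(** The clamp covers [t <= 0], where both sides hold because [i] is in [A]. In this form a bound on
    a sail coordinate becomes membership of a tuple entry in an index set. *)
Lemma le_inf_after A (i : elt A) t :
  le_inf t (card_after i) <-> mem A (proj1_sig i + Z.max t 0).
Proof.
destruct i as [i Hi]; unfold card_after; cbn [proj1_sig].
destruct (Z_le_gt_dec t 0) as [Ht|Ht].
- replace (i + Z.max t 0) with i by lia; split; auto using le_inf_nonpos.
- rewrite (le_inf_card_ray _ i 1 t); [|lia|intros; lia| |lia].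
  + replace (i + 1 * t) with (i + Z.max t 0) by lia; split; [tauto|split; auto; lia].
  + intros s u Hs [Hu _]; split; [|lia].
    apply (mem_convex _ _ _ _ Hi Hu); lia.
Qed.

Lemma le_inf_before A (i : elt A) t :
  le_inf (- t) (card_before i) <-> mem A (proj1_sig i + Z.min t 0).
Proof.
destruct i as [i Hi]; unfold card_before; cbn [proj1_sig].
destruct (Z_lt_ge_dec t 0) as [Ht|Ht].
- rewrite (le_inf_card_ray _ i (-1) (- t)); [|lia|intros; lia| |lia].
  + replace (i + -1 * - t) with (i + Z.min t 0) by lia; split; [tauto|split; auto; lia].
  + intros s u Hs [Hu _]; split; [|lia].
    apply (mem_convex _ _ _ _ Hu Hi); lia.
- replace (i + Z.min t 0) with i by lia; split; auto; intros _; apply le_inf_nonpos; lia.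
Qed.

Ltac tuple_eqs :=
  repeat match goal with
  | H : SixTuple _ _ _ _ _ _ = SixTuple _ _ _ _ _ _ |- _ => injection H; clear H; intros
  end.

Ltac act_cases :=
  repeat match goal with
  | |- context [?a <? ?b] => destruct (Z.ltb_spec a b)
  | |- context [?a =? ?b] => destruct (Z.eqb_spec a b)
  end; cbn [andb].

Ltac mem_tac :=
  match goal with H : mem ?A ?k |- mem ?A ?l => replace l with k by lia; exact H end.

(** * Coordinates *)

Section Coordinates.
Context {A B : index_set}.

Local Notation sail_class := (class (@sails_glue A B)).
Local Notation piece_class := (class (@piece_glue A B)).

(* Here and below the field [wy] holds 2y: this makes room for the otimes-vertices, which
   sit at half-integral y = (y' + y'') / 2. *)
Definition sail_point (s : sails_vertex A B) : six_tuple :=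
  match s with
  | inR j v => let (k, l) := proj1_sig v in
      let j := proj1_sig j in SixTuple (2 * l) (k + l) (2 * k) j (2 * j) j
  | inL i v => let (k, l) := proj1_sig v in
      let i := proj1_sig i in SixTuple (2 * i) (2 * i) (2 * i) k (k + l) l
  end.

Definition RA2_point (w : vertex (RA2 A B)) : six_tuple := lift sail_point w.

(** Here [p] is already twice the horizontal coordinate. It moves x' while negative and the doubled
    y while positive; likewise [q] moves x, then y''. *)
Definition left_point (i j : Z) (v : Z * Z) : six_tuple :=
  let (p, q) := v in
  SixTuple (2 * i + Z.min p 0) (2 * i + Z.min q 0) (2 * i)
    j (2 * j + Z.max p 0) (j + Z.max q 0).

Definition right_point (i j : Z) (v : Z * Z) : six_tuple :=
  let (p, s) := v in
  SixTuple (2 * i) (2 * i + Z.max s 0) (2 * i + Z.max p 0)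
    (j + Z.min s 0) (2 * j + Z.min p 0) j.

Definition piece_point (u : piece A B) : six_tuple :=
  match u with
  | frame w => RA2_point w
  | left_piece i j v => left_point (proj1_sig i) (proj1_sig j) (proj1_sig v)
  | right_piece i j v => right_point (proj1_sig i) (proj1_sig j) (proj1_sig v)
  end.

Definition glued_point (X : glued A B) : six_tuple := lift piece_point X.

(** Going through the diagonals of the sails makes these coordinates agree with those of the sail
    glued to the string. *)
Definition string_point (c : color) (i j t : Z) : six_tuple :=
  match c with
  | One => right_point i j (right_diagonal t)
  | Two => left_point i j (left_diagonal t)
  end.

Lemma string_pointE c i j t :
  string_point c i j t =
  match c with
  | One => SixTuple (2 * i) (2 * i + Z.max t 0) (2 * i + 2 * Z.max t 0)
             (j + Z.min t 0) (2 * j + Z.min t 0) j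
  | Two => SixTuple (2 * i + 2 * Z.min t 0) (2 * i + Z.min t 0) (2 * i)
             j (2 * j + Z.max t 0) (j + Z.max t 0)
  end.
Proof.
destruct c; cbn; unfold right_diagonal, left_diagonal; destruct (Z.leb_spec t 0);
  cbn; f_equal; lia.
Qed.

Lemma RA2_point_class s : RA2_point (sail_class s) = sail_point s.
Proof.
apply lift_class; intros _ _ [[i Hi] [j Hj]]; cbn; f_equal; lia.
Qed.

(** Right-sail vertices have y' = y'' and left-sail vertices have x' = x''; a tuple arising from
    both kinds therefore comes from two diagonal vertices, which are identified. *)
Lemma sail_point_inj s s' :
  sail_point s = sail_point s' -> sail_class s = sail_class s'.
Proof.
assert (Hglue : forall j u i v, sail_point (inR j u) = sail_point (inL i v) ->
  sail_class (inR j u) = sail_class (inL i v)).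
{ intros j u i v H.
  replace u with (diag_R i).
  - replace v with (diag_L j); [apply class_eq, rst_step; constructor|].
    destruct j as [j Hj], u as [[k l] Hu], i as [i Hi], v as [[m n] Hv]; cbn in *.
    tuple_eqs; apply sig_eq; cbn; f_equal; lia.
  - destruct j as [j Hj], u as [[k l] Hu], i as [i Hi], v as [[m n] Hv]; cbn in *.
    tuple_eqs; apply sig_eq; cbn; f_equal; lia. }
destruct s as [j u|i u], s' as [j' v|i' v]; intros H; auto;
  [f_equal|now symmetry; apply Hglue|f_equal].
- destruct j as [j Hj], u as [[k l] Hu], j' as [j' Hj'], v as [[m n] Hv]; cbn in *.
  tuple_eqs; f_equal; apply sig_eq; cbn; [lia|f_equal; lia].
- destruct i as [j Hj], u as [[k l] Hu], i' as [j' Hj'], v as [[m n] Hv]; cbn in *.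
  tuple_eqs; f_equal; apply sig_eq; cbn; [lia|f_equal; lia].
Qed.

Lemma RA2_point_inj w w' : RA2_point w = RA2_point w' -> w = w'.
Proof.
destruct (class_surj w) as [s ->], (class_surj w') as [s' ->].
rewrite !RA2_point_class; apply sail_point_inj.
Qed.

(** * Strings of the RA2-graph *)

Definition right_vertex {k l} (Hk : mem A k) (Hl : mem A l) (Hlk : l <= k) : right_sail A :=
  exist _ (k, l) (conj Hk (conj Hl Hlk)).

Definition left_vertex {k l} (Hk : mem B k) (Hl : mem B l) (Hkl : k <= l) : left_sail B :=
  exist _ (k, l) (conj Hk (conj Hl Hkl)).

Lemma principal_point i j :
  RA2_point (principal (A := A) (B := B) i j) =
  string_point One (proj1_sig i) (proj1_sig j) 0.
Proof. unfold principal; rewrite RA2_point_class; cbn; f_equal; lia. Qed.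

(** A I-string runs through [L_i] up to index 0 and through [R_j] afterwards, a II-string through
    [R_j] and then [L_i]. The clamps leave [i] or [j] on the side where the string does not move
    it. *)
Definition on_string (c : color) (i j t : Z) : Prop :=
  match c with
  | One => mem A (i + Z.max t 0) /\ mem B (j + Z.min t 0)
  | Two => mem A (i + Z.min t 0) /\ mem B (j + Z.max t 0)
  end.

Lemma on_string_intro c i j t w :
  RA2_point w = string_point c i j t -> on_string c i j t.
Proof.
destruct (class_surj w) as [[[j' Hj] [[k l] [Hk [Hl Hlk]]]|[i' Hi] [[k l] [Hk [Hl Hkl]]]] ->];
  rewrite RA2_point_class, string_pointE; destruct c; cbn in *; intros; tuple_eqs;
  split; mem_tac.
Qed.

Lemma RA2_edge_intro c w w' s s' : edge (sails A B) c s s' ->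
  RA2_point w = sail_point s -> RA2_point w' = sail_point s' -> edge (RA2 A B) c w w'.
Proof.
rewrite <- !RA2_point_class; intros H Hw Hw'; exists s, s'; auto using RA2_point_inj.
Qed.

Lemma string_edge c i j t w w' : mem A i -> mem B j ->
  RA2_point w = string_point c i j t -> RA2_point w' = string_point c i j (t + 1) ->
  edge (RA2 A B) c w w'.
Proof.
intros Hi Hj Hw Hw'.
assert (H := on_string_intro _ _ _ _ _ Hw); assert (H' := on_string_intro _ _ _ _ _ Hw').
rewrite string_pointE in Hw, Hw'.
(* The sign of [t] tells which sail holds the edge; the principal vertex, at [t = 0] or [t + 1 = 0],
   is represented in that same sail. *)
destruct c, H as [H1 H2], H' as [H1' H2'], (Z_lt_ge_dec t 0).
- assert (L : j + Z.min t 0 <= j) by lia; assert (L' : j + Z.min (t + 1) 0 <= j) by lia.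
  apply (RA2_edge_intro _ _ _ (inL (exist _ i Hi) (left_vertex H2 Hj L))
    (inL (exist _ i Hi) (left_vertex H2' Hj L'))); [split; auto|rewrite Hw|rewrite Hw'];
    cbn; f_equal; lia.
- assert (L : i <= i + Z.max t 0) by lia; assert (L' : i <= i + Z.max (t + 1) 0) by lia.
  apply (RA2_edge_intro _ _ _ (inR (exist _ j Hj) (right_vertex H1 Hi L))
    (inR (exist _ j Hj) (right_vertex H1' Hi L'))); [split; auto|rewrite Hw|rewrite Hw'];
    cbn; f_equal; lia.
- assert (L : i + Z.min t 0 <= i) by lia; assert (L' : i + Z.min (t + 1) 0 <= i) by lia.
  apply (RA2_edge_intro _ _ _ (inR (exist _ j Hj) (right_vertex Hi H1 L))
    (inR (exist _ j Hj) (right_vertex Hi H1' L'))); [split; auto|rewrite Hw|rewrite Hw'];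
    cbn; f_equal; lia.
- assert (L : j <= j + Z.max t 0) by lia; assert (L' : j <= j + Z.max (t + 1) 0) by lia.
  apply (RA2_edge_intro _ _ _ (inL (exist _ i Hi) (left_vertex Hj H2 L))
    (inL (exist _ i Hi) (left_vertex Hj H2' L'))); [split; auto|rewrite Hw|rewrite Hw'];
    cbn; f_equal; lia.
Qed.

Lemma on_string_elim c i j t : mem A i -> mem B j -> on_string c i j t ->
  exists w, RA2_point w = string_point c i j t.
Proof.
intros Hi Hj H; rewrite string_pointE.
destruct c, H as [H1 H2], (Z_lt_ge_dec t 0).
- unshelve eexists (class _ (inL (exist _ i Hi) (left_vertex H2 Hj _))); [lia|].
  rewrite RA2_point_class; cbn; f_equal; lia.
- unshelve eexists (class _ (inR (exist _ j Hj) (right_vertex H1 Hi _))); [lia|].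
  rewrite RA2_point_class; cbn; f_equal; lia.
- unshelve eexists (class _ (inR (exist _ j Hj) (right_vertex Hi H1 _))); [lia|].
  rewrite RA2_point_class; cbn; f_equal; lia.
- unshelve eexists (class _ (inL (exist _ i Hi) (left_vertex Hj H2 _))); [lia|].
  rewrite RA2_point_class; cbn; f_equal; lia.
Qed.

(** Only principal vertices lie in two sails. From the diagonal, colour I leaves only in the right
    sail and enters only in the left one, by the order conditions of the sails; colour II does the
    opposite. So the string has no branching. *)
Lemma string_step c i j w w' t : edge (RA2 A B) c w w' ->
  (0 <= t -> RA2_point w = string_point c i j t ->
     RA2_point w' = string_point c i j (t + 1)) /\
  (t < 0 -> RA2_point w' = string_point c i j (t + 1) ->
     RA2_point w = string_point c i j t).
Proof.
intros [s [s' [-> [-> H]]]]; rewrite !RA2_point_class, !string_pointE.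
destruct s as [[j1 Hj1] [[k l] [Hk [Hl Hkl]]]|[j1 Hj1] [[k l] [Hk [Hl Hkl]]]],
  s' as [[j2 Hj2] [[k' l'] [Hk' [Hl' Hkl']]]|[j2 Hj2] [[k' l'] [Hk' [Hl' Hkl']]]];
  try contradiction; destruct H as [H1 H2]; apply (f_equal (@proj1_sig _ _)) in H1;
  destruct c; cbn in *; injection H2; clear H2; intros; split; intros; tuple_eqs; f_equal; lia.
Qed.

Lemma path_point c (i : elt A) (j : elt B) D p t :
  is_path (RA2 A B) c D p -> D 0 -> p 0 = principal i j -> D t ->
  RA2_point (p t) = string_point c (proj1_sig i) (proj1_sig j) t.
Proof.
intros Hp H0 Hp0.
apply (path_values (RA2 A B) _ RA2_point (string_point c (proj1_sig i) (proj1_sig j)) c);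
  auto; [intros X Y s He; now apply (string_step c _ _ X Y s He)..|].
rewrite Hp0, principal_point, !string_pointE; destruct c; f_equal; lia.
Qed.

(** The path uses every index that carries a vertex. It is maximal because [path_point] prescribes
    the coordinates of any extension, whose indices thus already belong to [D]. *)
Lemma string_exists c (i : elt A) (j : elt B) t w :
  RA2_point w = string_point c (proj1_sig i) (proj1_sig j) t ->
  exists D p, is_maximal_path (RA2 A B) c D p /\ D 0 /\ p 0 = principal i j /\
    D t /\ p t = w.
Proof.
intros Hw; set (e := string_point c (proj1_sig i) (proj1_sig j)) in *.
set (D := fun t => exists w, RA2_point w = e t).
(* The principal vertex only witnesses that the type is inhabited; values outside [D] do not
   matter. *)
set (p := fun t => epsilon (inhabits (principal i j)) (fun w => RA2_point w = e t)).
assert (Hp : forall t, D t -> RA2_point (p t) = e t)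
  by (intros u Hu; exact (epsilon_spec _ _ Hu)).
assert (H0 : RA2_point (principal i j) = e 0).
{ rewrite principal_point; unfold e; rewrite !string_pointE; destruct c; f_equal; lia. }
assert (D0 : D 0) by now exists (principal i j).
assert (Dt : D t) by now exists w.
assert (Hp0 : p 0 = principal i j) by (apply RA2_point_inj; rewrite Hp; auto).
destruct i as [i Hi], j as [j Hj]; cbn [proj1_sig] in *.
exists D, p; repeat split; auto.
- intros s u v [w1 H1] [w2 H2] Hle; apply on_string_elim; auto.
  apply on_string_intro in H1, H2; destruct c, H1 as [H1 H1'], H2 as [H2 H2']; split.
  + apply (mem_convex _ _ _ _ H1 H2); lia.
  + apply (mem_convex _ _ _ _ H1' H2'); lia.
  + apply (mem_convex _ _ _ _ H1 H2); lia.
  + apply (mem_convex _ _ _ _ H1' H2'); lia.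
- intros u H1 H2; apply (string_edge c i j u); auto; now apply Hp.
- intros D' p' Hpath Hext u Hu; exists (p' u).
  apply (path_point c (exist _ i Hi) (exist _ j Hj) D'); auto; [now apply Hext|].
  destruct (Hext 0 D0) as [_ ->]; exact Hp0.
- apply RA2_point_inj; rewrite Hp; auto.
Qed.

(** * Gluing the sails *)

Lemma glued_point_class u : glued_point (piece_class u) = piece_point u.
Proof.
apply lift_class.
intros _ _ [i j D p t v [Hpath _] H0 Hp0 Ht Hv|i j D p t v [Hpath _] H0 Hp0 Ht Hv];
  cbn; rewrite Hv; [apply (path_point Two i j D)|apply (path_point One i j D)]; auto.
Qed.

Lemma left_glued w i j v t : RA2_point w = piece_point (left_piece i j v) ->
  proj1_sig v = left_diagonal t ->
  piece_class (frame w) = piece_class (left_piece i j v).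
Proof.
intros Hw Hv; cbn in Hw; rewrite Hv in Hw.
destruct (string_exists Two i j t w Hw) as [D [p [Hp [D0 [p0 [Dt <-]]]]]].
apply class_eq, rst_step; eapply glue_left; eauto.
Qed.

Lemma right_glued w i j v t : RA2_point w = piece_point (right_piece i j v) ->
  proj1_sig v = right_diagonal t ->
  piece_class (frame w) = piece_class (right_piece i j v).
Proof.
intros Hw Hv; cbn in Hw; rewrite Hv in Hw.
destruct (string_exists One i j t w Hw) as [D [p [Hp [D0 [p0 [Dt <-]]]]]].
apply class_eq, rst_step; eapply glue_right; eauto.
Qed.

(** With [p] doubled, the condition q >= 2p of integer points reads [p <= q], and half-integer
    points satisfy it with equality. The latter have positive [p], so the clamped [p / 2] is 0
    there. *)
Lemma in_left_Bsail_mem (i : elt A) (j : elt B) p q :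
  in_left_Bsail (card_before i) (card_after j) (p, q) <->
  mem A (proj1_sig i + Z.min (p / 2) 0) /\ mem B (proj1_sig j + Z.max q 0) /\ p <= q /\
  ((exists k, p = 2 * k /\ k <= q) \/ (exists k, 0 <= k /\ p = 2 * k + 1 /\ q = p)).
Proof.
unfold in_left_Bsail; split.
- intros [[k [s [H [Hr [Hle [Hm Hle']]]]]]|[k [H [Hle Hm]]]]; injection H; intros; subst.
  + rewrite le_inf_before in Hr; rewrite le_inf_after in Hm.
    replace (2 * k / 2) with k by (rewrite Z.mul_comm, Z.div_mul; lia).
    repeat split; auto; left; eauto.
  + rewrite le_inf_after in Hm.
    replace (Z.min ((2 * k + 1) / 2) 0) with 0
      by (assert (0 <= (2 * k + 1) / 2) by (apply Z.div_pos; lia); lia).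
    destruct i as [i Hi]; cbn in *; rewrite Z.add_0_r.
    repeat split; auto; [lia|right; eauto].
- intros [Hr [Hm [Hle [[k [-> Hk]]|[k [Hk [-> ->]]]]]]].
  + left; exists k, q; rewrite le_inf_before, le_inf_after.
    rewrite Z.mul_comm, Z.div_mul in Hr; auto; lia.
  + right; exists k; rewrite le_inf_after; auto.
Qed.

Lemma in_right_Bsail_mem (i : elt A) (j : elt B) p s :
  in_right_Bsail (card_before j) (card_after i) (p, s) <->
  mem A (proj1_sig i + Z.max (p / 2) 0) /\ mem B (proj1_sig j + Z.min s 0) /\ s <= p /\
  ((exists k, p = 2 * k /\ s <= k) \/ (exists k, 0 <= k /\ p = - (2 * k) - 1 /\ s = p)).
Proof.
unfold in_right_Bsail; split.
- intros [[k [q [H [Hr [Hle [Hm Hle']]]]]]|[k [H [Hle Hm]]]]; injection H; intros; subst.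
  + rewrite le_inf_before in Hr; rewrite le_inf_after in Hm.
    replace (2 * k / 2) with k by (rewrite Z.mul_comm, Z.div_mul; lia).
    repeat split; auto; left; eauto.
  + replace (2 * k + 1) with (- (- (2 * k) - 1)) in Hm by lia; rewrite le_inf_before in Hm.
    replace (Z.max ((- (2 * k) - 1) / 2) 0) with 0
      by (assert ((- (2 * k) - 1) / 2 < 0) by (apply Z.div_lt_upper_bound; lia); lia).
    destruct i as [i Hi]; cbn in *; rewrite Z.add_0_r.
    repeat split; auto; [lia|right; eauto].
- intros [Hr [Hm [Hle [[k [-> Hk]]|[k [Hk [-> ->]]]]]]].
  + left; exists k, s; rewrite le_inf_before, le_inf_after.
    rewrite Z.mul_comm, Z.div_mul in Hr; auto; lia.
  + right; exists k; replace (2 * k + 1) with (- (- (2 * k) - 1)) by lia.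
    rewrite le_inf_before; auto.
Qed.

Lemma on_left_diagonal w : exists (i : elt A) (j : elt B) t,
  RA2_point w = string_point Two (proj1_sig i) (proj1_sig j) t.
Proof.
destruct (class_surj w) as [[j [[k l] [Hk [Hl Hlk]]]|i [[k l] [Hk [Hl Hkl]]]] ->];
  rewrite RA2_point_class.
(* In either sail the colour II line through [(k, l)] meets the diagonal at [(k, k)], at distance
   [l - k]. *)
- exists (exist _ k Hk), j, (l - k); rewrite string_pointE; cbn in *; f_equal; lia.
- exists i, (exist _ k Hk), (l - k); rewrite string_pointE; cbn in *; f_equal; lia.
Qed.

Lemma left_diagonal_in (i : elt A) (j : elt B) t :
  on_string Two (proj1_sig i) (proj1_sig j) t ->
  in_left_Bsail (card_before i) (card_after j) (left_diagonal t).
Proof.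
intros [Hi Hj]; unfold left_diagonal; destruct (Z.leb_spec t 0); apply in_left_Bsail_mem.
- rewrite Z.mul_comm, Z.div_mul by lia.
  repeat split; auto; [lia|left; exists t; lia].
- repeat split; auto; [|lia|].
  + assert (0 <= t / 2) by (apply Z.div_pos; lia).
    replace (Z.min (t / 2) 0) with (Z.min t 0) by lia; exact Hi.
  + destruct (Z.Even_or_Odd t) as [[k ->]|[k ->]].
    * left; exists k; lia.
    * right; exists k; lia.
Qed.

(** This removes frame vertices from later case analyses: every class has a representative in a
    sail. *)
Lemma frame_on_left w : exists i j v,
  piece_class (frame w) = piece_class (left_piece i j v).
Proof.
destruct (on_left_diagonal w) as [i [j [t Ht]]].
assert (H := left_diagonal_in i j t (on_string_intro _ _ _ _ _ Ht)).
exists i, j, (exist _ _ H); now apply (left_glued _ _ _ _ t).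
Qed.

(** A common tuple satisfies the opposite inequalities of both regions, hence 2x = x' + x'' and 2y =
    y' + y''. Both points are then on their diagonals and are glued to the same vertex of C(A,B). *)
Lemma left_right_glued i j u i' j' v :
  piece_point (left_piece i j u) = piece_point (right_piece i' j' v) ->
  piece_class (left_piece i j u) = piece_class (right_piece i' j' v).
Proof.
destruct u as [[p q] Hu], v as [[p' s] Hv]; intros H.
assert (Hu' := Hu); apply in_left_Bsail_mem in Hu'; destruct Hu' as [Hi [Hj [Hpq Hp]]].
assert (Hv' := Hv); apply in_right_Bsail_mem in Hv'; destruct Hv' as [_ [_ [Hps Hp']]].
assert (Hq : (p, q) = left_diagonal q /\ (p', s) = right_diagonal s).
{ cbn in H; tuple_eqs; unfold left_diagonal, right_diagonal.
  destruct (Z.leb_spec q 0), (Z.leb_spec s 0); split; f_equal;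
    destruct Hp as [[k Hk]|[k Hk]], Hp' as [[k' Hk']|[k' Hk']]; lia. }
destruct Hq as [Hq Hs].
destruct (on_string_elim Two (proj1_sig i) (proj1_sig j) q) as [w Hw];
  [apply (proj2_sig i)|apply (proj2_sig j)| |].
{ split; auto; unfold left_diagonal in Hq.
  destruct (Z.leb_spec q 0); injection Hq; intros ->.
  - rewrite Z.mul_comm, Z.div_mul in Hi by lia; exact Hi.
  - assert (0 <= q / 2) by (apply Z.div_pos; lia); mem_tac. }
assert (Hleft : RA2_point w = piece_point (left_piece i j (exist _ (p, q) Hu)))
  by (rewrite Hw; cbn; now rewrite <- Hq).
transitivity (piece_class (frame w)).
- symmetry; exact (left_glued _ _ _ _ q Hleft Hq).
- apply (right_glued _ _ _ _ s); [exact (eq_trans Hleft H)|exact Hs].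
Qed.

(** Within one kind of sail, two entries of the tuple name the sail, and the clamped parts of [p]
    and [q] determine the point. *)
Lemma piece_point_inj u v : piece_point u = piece_point v ->
  piece_class u = piece_class v.
Proof.
assert (Hframe : forall u, exists u', piece_class u = piece_class u' /\
  match u' with frame _ => False | _ => True end).
{ intros [w|i j x|i j x].
  - destruct (frame_on_left w) as [i [j [x Hx]]]; now exists (left_piece i j x).
  - now exists (left_piece i j x).
  - now exists (right_piece i j x). }
rewrite <- !glued_point_class.
destruct (Hframe u) as [u' [-> Hu]], (Hframe v) as [v' [-> Hv]].
rewrite !glued_point_class; clear u v Hframe.
destruct u' as [|i j u|i j u]; [contradiction| |]; destruct v' as [|i' j' v|i' j' v];
  try contradiction; intros H.
- assert (E : i = i' /\ j = j').
  { destruct u as [[p q] Hu'], v as [[p' q'] Hv']; cbn in H; tuple_eqs.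
    split; apply sig_eq; lia. }
  destruct E as [-> ->]; f_equal; f_equal; apply sig_eq.
  destruct u as [[p q] Hu'], v as [[p' q'] Hv']; cbn in *; tuple_eqs; f_equal; lia.
- now apply left_right_glued.
- symmetry; now apply left_right_glued.
- assert (E : i = i' /\ j = j').
  { destruct u as [[p q] Hu'], v as [[p' q'] Hv']; cbn in H; tuple_eqs.
    split; apply sig_eq; lia. }
  destruct E as [-> ->]; f_equal; f_equal; apply sig_eq.
  destruct u as [[p q] Hu'], v as [[p' q'] Hv']; cbn in *; tuple_eqs; f_equal; lia.
Qed.

Lemma glued_point_inj X Y : glued_point X = glued_point Y -> X = Y.
Proof.
destruct (class_surj X) as [u ->], (class_surj Y) as [v ->].
rewrite !glued_point_class; apply piece_point_inj.
Qed.

(** * The image of the coordinates *)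

Definition in_box (T : six_tuple) : Prop :=
  exists k l, wx1 T = 2 * k /\ wx2 T = 2 * l /\ mem A k /\ mem A l /\
    mem B (wy1 T) /\ mem B (wy2 T).

(** Conditions (B) and (C) for doubled y. An odd value is allowed only at the midpoint, where the
    otimes-vertices are. *)
Definition ordered (T : six_tuple) : Prop :=
  let (x1, x, x2, y1, y, y2) := T in
  x1 <= x <= x2 /\ 2 * y1 <= y <= 2 * y2 /\
  (y < 2 * y2 -> x2 = x) /\ (2 * y1 < y -> x = x1) /\
  ((exists h, y = 2 * h) \/ (y = y1 + y2 /\ exists h, y = 2 * h + 1)).

Lemma glued_point_valid X : in_box (glued_point X) /\ ordered (glued_point X).
Proof.
destruct (class_surj X) as [u ->].
assert (Hleft : forall i j v, in_box (piece_point (left_piece i j v)) /\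
  ordered (piece_point (left_piece i j v))).
{ intros [i Hi] [j Hj] [[p q] Hv]; assert (H := Hv); apply in_left_Bsail_mem in H.
  destruct H as [Hp [Hq [Hpq [[k [-> Hk]]|[k [Hk [-> ->]]]]]]]; cbn in *; split;
    unfold in_box; cbn.
  - rewrite Z.mul_comm, Z.div_mul in Hp by lia.
    exists (i + Z.min k 0), i; repeat split; auto; lia.
  - repeat split; try lia; left; exists (j + Z.max k 0); lia.
  - exists i, i; repeat split; auto; lia.
  - repeat split; try lia; right; split; [lia|exists (j + k); lia]. }
destruct u as [w|i j v|[i Hi] [j Hj] [[p s] Hv]].
- destruct (frame_on_left w) as [i [j [v ->]]]; rewrite glued_point_class; auto.
- rewrite glued_point_class; auto.
- rewrite glued_point_class; assert (H := Hv); apply in_right_Bsail_mem in H.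
  destruct H as [Hp [Hq [Hpq [[k [-> Hk]]|[k [Hk [-> ->]]]]]]]; cbn in *; split;
    unfold in_box; cbn.
  + rewrite Z.mul_comm, Z.div_mul in Hp by lia.
    exists i, (i + Z.max k 0); repeat split; auto; lia.
  + repeat split; try lia; left; exists (j + Z.min k 0); lia.
  + exists i, i; repeat split; auto; lia.
  + repeat split; try lia; right; split; [lia|exists (j - k - 1); lia].
Qed.

Definition left_region (T : six_tuple) : Prop :=
  wx1 T + wx2 T <= 2 * wx T /\ wy T <= wy1 T + wy2 T.
Definition right_region (T : six_tuple) : Prop :=
  2 * wx T <= wx1 T + wx2 T /\ wy1 T + wy2 T <= wy T.

(** Inverse of [left_point]: each coordinate is the sum of its negative and positive parts. *)
Definition left_coords (T : six_tuple) : Z * Z :=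
  let (x1, x, x2, y1, y, y2) := T in (x1 - x2 + (y - 2 * y1), x - x2 + (y2 - y1)).
Definition right_coords (T : six_tuple) : Z * Z :=
  let (x1, x, x2, y1, y, y2) := T in (x2 - x1 + (y - 2 * y2), x - x1 + (y1 - y2)).

Lemma left_region_elim T (i : elt A) (j : elt B) :
  in_box T -> ordered T -> left_region T ->
  wx2 T = 2 * proj1_sig i -> wy1 T = proj1_sig j ->
  exists v, proj1_sig v = left_coords T /\ piece_point (left_piece i j v) = T.
Proof.
destruct T as [x1 x x2 y1 y y2], i as [i Hi], j as [j Hj].
unfold in_box, left_region; cbn; intros [k [l [Hk [Hl [Ak [Al [By1 By2]]]]]]].
intros [Hx [Hy [Hc [Hd Hpar]]]] [Hregx Hregy] Ei Ej; subst.
assert (Hin : in_left_Bsail (card_before (exist _ i Hi)) (card_after (exist _ j Hj))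
  (2 * k - 2 * i + (y - 2 * j), x - 2 * i + (y2 - j))).
{ apply in_left_Bsail_mem; cbn.
  destruct Hpar as [[h ->]|[-> [h Hh]]].
  - replace (2 * k - 2 * i + (2 * h - 2 * j)) with ((k - i + (h - j)) * 2) by lia.
    rewrite Z.div_mul by lia; repeat split; try mem_tac; [lia|].
    left; exists (k - i + (h - j)); lia.
  (* An odd doubled y lies strictly between 2y' and 2y'', so (C) gives x' = x = x'' and the sail
     point is a half-integer one. *)
  - replace (2 * k - 2 * i + (j + y2 - 2 * j)) with (1 + (h - j) * 2) by lia.
    rewrite Z.div_add by lia; replace (1 / 2) with 0 by reflexivity.
    repeat split; try mem_tac; [lia|right; exists (h - j); lia]. }
exists (exist _ _ Hin); split; cbn; f_equal; lia.
Qed.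

Lemma right_region_elim T (i : elt A) (j : elt B) :
  in_box T -> ordered T -> right_region T ->
  wx1 T = 2 * proj1_sig i -> wy2 T = proj1_sig j ->
  exists v, proj1_sig v = right_coords T /\ piece_point (right_piece i j v) = T.
Proof.
destruct T as [x1 x x2 y1 y y2], i as [i Hi], j as [j Hj].
unfold in_box, right_region; cbn; intros [k [l [Hk [Hl [Ak [Al [By1 By2]]]]]]].
intros [Hx [Hy [Hc [Hd Hpar]]]] [Hregx Hregy] Ei Ej; subst.
assert (Hin : in_right_Bsail (card_before (exist _ j Hj)) (card_after (exist _ i Hi))
  (2 * l - 2 * i + (y - 2 * j), x - 2 * i + (y1 - j))).
{ apply in_right_Bsail_mem; cbn.
  destruct Hpar as [[h ->]|[-> [h Hh]]].
  - replace (2 * l - 2 * i + (2 * h - 2 * j)) with ((l - i + (h - j)) * 2) by lia.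
    rewrite Z.div_mul by lia; repeat split; try mem_tac; [lia|].
    left; exists (l - i + (h - j)); lia.
  - replace (2 * l - 2 * i + (y1 + j - 2 * j)) with (1 + (h - j) * 2) by lia.
    rewrite Z.div_add by lia; replace (1 / 2) with 0 by reflexivity.
    repeat split; try mem_tac; [lia|right; exists (j - h - 1); lia]. }
exists (exist _ _ Hin); split; cbn; f_equal; lia.
Qed.

Lemma glued_point_surj T : in_box T -> ordered T -> exists X, glued_point X = T.
Proof.
intros Hbox Hord; assert (Hreg : left_region T \/ right_region T).
(* By (C), y < y'' forces x = x'' and y > y' forces x = x'. Hence 2x - x' - x'' and y' + y'' - 2y
   never have strictly opposite signs. *)
{ destruct T as [x1 x x2 y1 y y2]; unfold left_region, right_region; cbn in *; lia. }
assert (H := Hbox); destruct H as [k [l [Hk [Hl [Ak [Al [By1 By2]]]]]]].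
destruct Hreg as [Hreg|Hreg].
- destruct (left_region_elim T (exist _ l Al) (exist _ _ By1)) as [v [_ Hv]]; auto.
  exists (class _ (left_piece _ _ v)); rewrite glued_point_class; exact Hv.
- destruct (right_region_elim T (exist _ k Ak) (exist _ _ By2)) as [v [_ Hv]]; auto.
  exists (class _ (right_piece _ _ v)); rewrite glued_point_class; exact Hv.
Qed.

(** In [L_i] the doubled y of [(k, l)] is [k + l], of the same parity as [l - k]. Conversely an odd
    value forces x' = x = x'', so the tuple comes from the vertex (y', y'') of a left sail. *)
Lemma is_otimes_odd (X : glued A B) : is_otimes X <-> Z.Odd (wy (glued_point X)).
Proof.
split.
- intros [w [[i [[[k l] [Hk [Hl Hkl]]] [-> [h Hh]]]] ->]].
  rewrite glued_point_class; cbn; rewrite RA2_point_class; exists (h + k); cbn in *; lia.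
- intros [h Hh]; destruct (glued_point_valid X) as [Hbox Hord].
  destruct (glued_point X) as [x1 x x2 y1 y y2] eqn:E.
  destruct Hbox as [k [l [Hk [Hl [Ak [Al [By1 By2]]]]]]]; cbn in *.
  destruct Hord as [Hx [Hy [Hc [Hd [[m Hm]|[Hm _]]]]]]; [lia|].
  assert (Hle : y1 <= y2) by lia.
  set (v := left_vertex By1 By2 Hle).
  exists (class _ (inL (exist _ k Ak) v)); split.
  + exists (exist _ k Ak), v; split; [reflexivity|exists (h - y1); cbn; lia].
  + apply glued_point_inj; rewrite glued_point_class; cbn; rewrite RA2_point_class, E; cbn.
    f_equal; lia.
Qed.

(** * Edges *)

(** Equal x'' and y' place both ends in the same left sail. *)
Lemma left_image_intro E (X Y : glued A B) :
  left_region (glued_point X) -> left_region (glued_point Y) ->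
  wx2 (glued_point X) = wx2 (glued_point Y) ->
  wy1 (glued_point X) = wy1 (glued_point Y) ->
  E (left_coords (glued_point X)) (left_coords (glued_point Y)) -> left_image E X Y.
Proof.
intros HX HY Hx Hy HE.
destruct (glued_point_valid X) as [HbX HoX], (glued_point_valid Y) as [HbY HoY].
assert (H := HbX); destruct H as [k [l [Hk [Hl [Ak [Al [By1 By2]]]]]]].
destruct (left_region_elim (glued_point X) (exist _ l Al) (exist _ _ By1)) as [u [Hu HuX]]; auto.
destruct (left_region_elim (glued_point Y) (exist _ l Al) (exist _ _ By1)) as [v [Hv HvY]];
  auto; cbn [proj1_sig]; try congruence.
exists (exist _ l Al), (exist _ _ By1), u, v; split; [|split].
- apply glued_point_inj; now rewrite glued_point_class.
- apply glued_point_inj; now rewrite glued_point_class.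
- now rewrite Hu, Hv.
Qed.

Lemma right_image_intro E (X Y : glued A B) :
  right_region (glued_point X) -> right_region (glued_point Y) ->
  wx1 (glued_point X) = wx1 (glued_point Y) ->
  wy2 (glued_point X) = wy2 (glued_point Y) ->
  E (right_coords (glued_point X)) (right_coords (glued_point Y)) -> right_image E X Y.
Proof.
intros HX HY Hx Hy HE.
destruct (glued_point_valid X) as [HbX HoX], (glued_point_valid Y) as [HbY HoY].
assert (H := HbX); destruct H as [k [l [Hk [Hl [Ak [Al [By1 By2]]]]]]].
destruct (right_region_elim (glued_point X) (exist _ k Ak) (exist _ _ By2)) as [u [Hu HuX]]; auto.
destruct (right_region_elim (glued_point Y) (exist _ k Ak) (exist _ _ By2)) as [v [Hv HvY]];
  auto; cbn [proj1_sig]; try congruence.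
exists (exist _ k Ak), (exist _ _ By2), u, v; split; [|split].
- apply glued_point_inj; now rewrite glued_point_class.
- apply glued_point_inj; now rewrite glued_point_class.
- now rewrite Hu, Hv.
Qed.

Definition double_y (T : six_tuple) : six_tuple :=
  let (x1, x, x2, y1, y, y2) := T in SixTuple x1 x x2 y1 (2 * y) y2.

Lemma S_edge_act c X Y T T' :
  glued_point X = double_y T -> glued_point Y = double_y T' ->
  S_edge c X Y -> T' = act c T.
Proof.
destruct T as [x1 x x2 y1 y y2], T' as [x1' x' x2' y1' y' y2']; cbn; intros HX HY.
intros [H|[H|[-> [w [_ [H1 H2]]]]]].
- destruct H as [i [j [[u1 Hu] [[v1 Hv] [-> [-> [p [q [Eu Ev]]]]]]]]].
  cbn in Eu, Ev; subst u1; rewrite glued_point_class in HX, HY; cbn in HX, HY.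
  apply in_left_Bsail_mem in Hu; destruct Hu as [_ [_ [Hu _]]].
  (* The head has an even first coordinate, so the half-integer alternative is void; the integer one
     supplies the bound [k <= q] needed to select the clause of the action. *)
  destruct c; subst v1; apply in_left_Bsail_mem in Hv;
    destruct Hv as [_ [_ [Hv [[k Hk]|[k Hk]]]]];
    cbn in *; tuple_eqs; act_cases; f_equal; lia.
- destruct H as [i [j [[u1 Hu] [[v1 Hv] [-> [-> [p [q [Eu Ev]]]]]]]]].
  cbn in Eu, Ev; subst u1; rewrite glued_point_class in HX, HY; cbn in HX, HY.
  apply in_right_Bsail_mem in Hu; destruct Hu as [_ [_ [Hu [[k Hk]|[k Hk]]]]].
  all: destruct c; subst v1; apply in_right_Bsail_mem in Hv;
    destruct Hv as [_ [_ [Hv _]]]; cbn in *; tuple_eqs; act_cases; f_equal; lia.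
(* Equating the coordinates of the otimes-vertex in its two sails gives [i = i'] and [k = k'].
   Doubled y passes from one below the midpoint to one above it: this is clause (ii). *)
- destruct H1 as [i [j [[u1 Hu] [[v1 Hv] [-> [-> [k [Eu Ev]]]]]]]].
  destruct H2 as [i' [j' [[u1' Hu'] [[v1' Hv'] [Hw [-> [k' [Eu' Ev']]]]]]]].
  cbn in Eu, Ev, Eu', Ev'; subst u1 v1 u1' v1'.
  apply (f_equal glued_point) in Hw; rewrite !glued_point_class in Hw.
  rewrite glued_point_class in HX, HY; cbn in Hw, HX, HY.
  apply in_left_Bsail_mem in Hv; apply in_right_Bsail_mem in Hu'.
  destruct Hv as [_ [_ [_ [[h Hh]|[h Hh]]]]]; [lia|].
  destruct Hu' as [_ [_ [_ [[h' Hh']|[h' Hh']]]]]; [lia|].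
  tuple_eqs; cbn [act act1]; act_cases; f_equal; lia.
Qed.

(** The witnesses are the entries of [left_coords] at the tail, the first one halved. *)
Ltac left_edge :=
  match goal with
  | HX : glued_point ?X = SixTuple (2 * ?k) ?x (2 * ?l) ?y1 (2 * ?y) ?y2,
    HY : glued_point ?Y = _ |- S_edge _ ?X ?Y =>
      left; apply left_image_intro; rewrite ?HX, ?HY; unfold left_region; cbn; try lia;
      exists (k - l + (y - y1)), (x - 2 * l + (y2 - y1)); split; f_equal; lia
  end.
Ltac right_edge :=
  match goal with
  | HX : glued_point ?X = SixTuple (2 * ?k) ?x (2 * ?l) ?y1 (2 * ?y) ?y2,
    HY : glued_point ?Y = _ |- S_edge _ ?X ?Y =>
      right; left; apply right_image_intro; rewrite ?HX, ?HY; unfold right_region; cbn;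
      try lia;
      exists (l - k + (y - y2)), (x - 2 * k + (y1 - y2)); split; f_equal; lia
  end.

Lemma act_S_edge c X Y T :
  glued_point X = double_y T -> glued_point Y = double_y (act c T) -> S_edge c X Y.
Proof.
intros HX HY.
destruct (glued_point_valid X) as [HbX HoX], (glued_point_valid Y) as [HbY HoY].
rewrite HX in HbX, HoX; rewrite HY in HbY, HoY.
destruct HbX as [k [l [Hk [Hl [Ak [Al [By1 By2]]]]]]].
destruct T as [x1 x x2 y1 y y2]; cbn [double_y wx1 wx2 wy1 wy2 ordered] in *; subst x1 x2.
destruct HoX as [Hx [Hy [Hc [Hd _]]]].
destruct c; cbn [act act1 act2] in *.
(* In clause (i), x' + x'' is even and below 2x, so raising x' by 2 stays in the left region. *)
- destruct (Z.ltb_spec (2 * k + 2 * l) (2 * x)); [left_edge|].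
  destruct (Z.eqb_spec x (2 * k)), (Z.eqb_spec x (2 * l)), (Z.ltb_spec y y2); cbn [andb] in *;
    try right_edge.
  destruct (Z_le_gt_dec (2 * (y + 1)) (y1 + y2)); [left_edge|].
  destruct (Z_le_gt_dec (y1 + y2) (2 * y)); [right_edge|].
  right; right; split; [reflexivity|].
  (* Now 2y + 1 = y' + y''; the otimes-vertex passed over has this number as its doubled y. *)
  destruct (glued_point_surj (SixTuple (2 * k) x (2 * l) y1 (2 * y + 1) y2)) as [w Hw].
  { exists k, l; repeat split; auto. }
  { cbn; repeat split; try lia; right; split; [lia|exists y; lia]. }
  exists w; split; [|split].
  + apply is_otimes_odd; rewrite Hw; exists y; reflexivity.
  + apply left_image_intro; rewrite ?HX, ?Hw; unfold left_region; cbn; try lia.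
    exists (y - y1); split; f_equal; lia.
  + apply right_image_intro; rewrite ?Hw, ?HY; unfold right_region; cbn; try lia.
    exists (y2 - y - 1); split; f_equal; lia.
- destruct (Z.ltb_spec (y1 + y2) (2 * y)); [right_edge|].
  destruct (Z.eqb_spec y y1), (Z.eqb_spec y y2), (Z.ltb_spec x (2 * l)); cbn [andb] in *;
    try left_edge.
  (* Clause (v) cannot jump across: x' and x'' being even, the midpoint [k + l] is an integer and x
     moves by 1. *)
  destruct (Z_le_gt_dec (k + l) x); [left_edge|right_edge].
Qed.

End Coordinates.

(** * The isomorphism *)

Lemma above_le a z z' : above a z -> z <= z' -> above a z'.
Proof. destruct a; cbn; lia. Qed.

Lemma below_le b z z' : below b z' -> z <= z' -> below b z.
Proof. destruct b; cbn; lia. Qed.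

(** The offsets [c1] and [c2] align the index sets with arbitrary bounds. Translating the x-entries
    by [2 * c1] and the y-entries by [c2] preserves parity in x and commutes with both actions. *)
Lemma S_graph_worm A B a1 b1 a2 b2 c1 c2 :
  (forall k, mem A k <-> above a1 (k + c1) /\ below b1 (k + c1)) ->
  (forall k, mem B k <-> above a2 (k + c2) /\ below b2 (k + c2)) ->
  isomorphic (S_graph A B) (worm a1 b1 a2 b2).
Proof.
intros HA HB.
set (shift := fun T : six_tuple => let (x1, x, x2, y1, y, y2) := T in
  SixTuple (x1 + 2 * c1) (x + 2 * c1) (x2 + 2 * c1) (y1 + c2) (y + c2) (y2 + c2)).
assert (Hact : forall c T, act c (shift T) = shift (act c T)).
{ intros c [x1 x x2 y1 y y2]; destruct c; cbn; act_cases; cbn; f_equal; lia. }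
assert (Hshift : forall T T', shift T = shift T' -> T = T').
{ intros [x1 x x2 y1 y y2] [x1' x' x2' y1' y' y2'] H; cbn in H; tuple_eqs; f_equal; lia. }
assert (Hd : forall (o : option Z) z, above (double o) (2 * z) <-> above o z)
  by (intros [o|] z; cbn; lia).
assert (Hd' : forall (o : option Z) z, below (double o) (2 * z) <-> below o z)
  by (intros [o|] z; cbn; lia).
set (tuple := fun v : vertex (worm a1 b1 a2 b2) => proj1_sig (proj1_sig v)).
assert (Hsub : forall X : vertex (S_graph A B), exists v : vertex (worm a1 b1 a2 b2),
  exists T, glued_point (proj1_sig X) = double_y T /\ tuple v = shift T).
{ intros [X HX]; cbn [proj1_sig]; rewrite is_otimes_odd in HX.
  destruct (glued_point_valid X) as [[k [l [Hk [Hl [Ak [Al [By1 By2]]]]]]] Hord].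
  destruct (glued_point X) as [x1 x x2 y1 y y2]; cbn in *; subst x1 x2.
  (* Off the otimes-vertices the doubled y is even and can be halved. *)
  destruct Hord as [Hx [Hy [Hc [Hc' [[h ->]|[_ [h Hh]]]]]]]; [|destruct HX; now exists h].
  set (T := SixTuple (2 * k) x (2 * l) y1 h y2).
  assert (Hadm : admissible (shift T)).
  { cbn; repeat split; try lia; [exists (k + c1)|exists (l + c1)]; lia. }
  apply HA in Ak, Al; apply HB in By1, By2.
  unshelve eexists (exist _ (exist _ (shift T) Hadm) _); [|exists T; auto].
  cbn; rewrite <- !Z.mul_add_distr_l, Hd, Hd'; tauto. }
set (f := fun X => proj1_sig (constructive_indefinite_description _ (Hsub X))).
assert (Hf : forall X, exists T, glued_point (proj1_sig X) = double_y T /\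
  tuple (f X) = shift T).
{ intros X; unfold f; now destruct constructive_indefinite_description. }
apply (isomorphism_intro _ _ f).
- intros X Y E; destruct (Hf X) as [T [HX HT]], (Hf Y) as [T' [HY HT']].
  apply sig_eq, glued_point_inj; rewrite HX, HY; f_equal; apply Hshift.
  rewrite <- HT, <- HT', E; reflexivity.
- intros [[[x1 x x2 y1 y y2] Hadm] Hbox]; cbn in Hbox; assert (H := Hadm).
  destruct H as [[[k ->] [l ->]] [[Hy Hx] [Hc Hd1]]].
  set (T := SixTuple (2 * (k - c1)) (x - 2 * c1) (2 * (l - c1)) (y1 - c2) (y - c2) (y2 - c2)).
  destruct (@glued_point_surj A B (double_y T)) as [X HX].
  + rewrite Hd, Hd' in Hbox; destruct Hbox as [H1 [H2 [H3 H4]]].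
    exists (k - c1), (l - c1); cbn [double_y wx1 wx2 wy1 wy2 T]; rewrite !HA, !HB.
    repeat split;
      first [refine (above_le _ _ _ H1 _); lia|refine (below_le _ _ _ H2 _); lia
            |refine (above_le _ _ _ H3 _); lia|refine (below_le _ _ _ H4 _); lia].
  + cbn; repeat split; try lia; left; eexists; reflexivity.
  + assert (HX' : ~ is_otimes X).
    { rewrite is_otimes_odd, HX; cbn; intros [h Hh]; lia. }
    exists (exist _ X HX'); destruct (Hf (exist _ X HX')) as [T' [HT' Hv]].
    do 2 apply sig_eq; refine (eq_trans Hv _); cbn in HT'; rewrite HX in HT'.
    destruct T'; cbn in *; tuple_eqs; f_equal; lia.
- intros c X Y; destruct (Hf X) as [T [HX HT]], (Hf Y) as [T' [HY HT']].
  change (S_edge c (proj1_sig X) (proj1_sig Y) <->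
    tuple (f Y) = act c (tuple (f X))).
  rewrite HT, HT', Hact; split.
  + intros H; f_equal; exact (S_edge_act _ _ _ _ _ HX HY H).
  + intros H; apply Hshift in H; subst T'; now apply (act_S_edge _ _ _ T).
Qed.

Lemma index_set_of_bounds a b : bounds_le a b ->
  exists A c, forall k, mem A k <-> above a (k + c) /\ below b (k + c).
Proof.
destruct a as [a|], b as [b|]; cbn; intros Hle.
- exists (Segment (Z.to_nat (b - a))), a; intros k; cbn; lia.
- exists NonNegatives, a; intros k; cbn; lia.
- exists NonPositives, b; intros k; cbn; lia.
- exists Integers, 0; intros k; cbn; tauto.
Qed.

Lemma bounds_of_index_set A : exists a b, bounds_le a b /\
  forall k, mem A k <-> above a (k + 0) /\ below b (k + 0).
Proof.
destruct A as [n| | |].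
- exists (Some 0), (Some (Z.of_nat n)); cbn; split; [lia|intros; lia].
- exists (Some 0), None; cbn; split; [exact I|intros; lia].
- exists None, (Some 0); cbn; split; [exact I|intros; lia].
- exists None, None; cbn; split; [exact I|intros; tauto].
Qed.

Theorem theorem9 :
  (forall a1 b1 a2 b2 : option Z, bounds_le a1 b1 -> bounds_le a2 b2 ->
     exists A B : index_set, isomorphic (worm a1 b1 a2 b2) (S_graph A B)) /\
  (forall A B : index_set,
     exists a1 b1 a2 b2 : option Z, bounds_le a1 b1 /\ bounds_le a2 b2 /\
       isomorphic (S_graph A B) (worm a1 b1 a2 b2)).
Proof.
split.
- intros a1 b1 a2 b2 H1 H2.
  destruct (index_set_of_bounds a1 b1 H1) as [A [c1 HA]].
  destruct (index_set_of_bounds a2 b2 H2) as [B [c2 HB]].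
  exists A, B; apply isomorphic_sym, (S_graph_worm A B a1 b1 a2 b2 c1 c2); auto.
- intros A B.
  destruct (bounds_of_index_set A) as [a1 [b1 [H1 HA]]].
  destruct (bounds_of_index_set B) as [a2 [b2 [H2 HB]]].
  exists a1, b1, a2, b2; repeat split; auto.
  apply (S_graph_worm A B a1 b1 a2 b2 0 0); auto.
Qed.
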